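(* Let $A$ be an Artin algebra with ADR algebra $R_A=\operatorname{End}_A(G)^{op}$. Let $M$ be a rigid $A$-module of Loewy length $m$, and let $\varepsilon$ be the projective cover of $M$ in the category of $(A/\operatorname{Rad}^mA)$-modules. Then $\operatorname{Hom}_A(G,\varepsilon)$ is the projective cover of $\operatorname{Hom}_A(G,M)$ in the category of $R_A$-modules.
   Context: All modules are finitely generated left modules. Let $\{P_1,\dots,P_n\}$ be a complete set of pairwise non-isomorphic projective indecomposable $A$-modules and $l_i$ the Loewy length of $P_i$. Put $G=\bigoplus_{i=1}^n\bigoplus_{j=1}^{l_i}P_i/\operatorname{Rad}^jP_i$; the ADR algebra of $A$ is $R_A=\operatorname{End}_A(G)^{op}$, and $\operatorname{Hom}_A(G,-)$ is a functor from $A$-modules to left $R_A$-modules. A module is rigid if its radical series coincides with its socle series (so, if $M$ has Loewy length $m$, $\operatorname{Rad}^{m-j}M=\operatorname{Soc}_jM$ for $0\leq j\leq m$). A module of Loewy length $m$ is naturally an $(A/\operatorname{Rad}^mA)$-module, and $(A/\operatorname{Rad}^mA)$-modules are regarded as $A$-modules. *)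

(* Defs.v *)
From HB Require Import structures.
From mathcomp Require Import all_boot all_algebra ring_quotient.
From mathcomp Require Import boolp.

Set Implicit Arguments.
Unset Strict Implicit.
Unset Printing Implicit Defensive.

Import GRing.Theory.
Local Open Scope ring_scope.
Local Open Scope quotient_scope.

(* A module is an [lmodType], i.e. a left module, and a submodule
   is an element of [submodClosed M]; membership is decided classically. *)

Section PropSubmodules.
Variables (R : pzRingType) (M : lmodType R).

Definition submod_prop (S : M -> Prop) : Prop :=
  S 0 /\ forall (a : R) (u v : M), S u -> S v -> S (a *: u + v).

Definition psub (S : M -> Prop) of submod_prop S : {pred M} :=
  fun x => `[< S x >].

Lemma psubE S (HS : submod_prop S) x : (x \in psub HS) = `[< S x >].
Proof. by []. Qed.

Lemma psubP S (HS : submod_prop S) x : (x \in psub HS) <-> S x.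
Proof. by rewrite psubE; split=> /asboolP. Qed.

Lemma psub_closed S (HS : submod_prop S) : GRing.submod_closed (psub HS).
Proof.
split=> [|a u v /asboolP Su /asboolP Sv]; apply/asboolP; first exact: HS.1.
exact: HS.2.
Qed.

HB.instance Definition _ S (HS : submod_prop S) :=
  GRing.isSubmodClosed.Build R M (psub HS) (psub_closed HS).

HB.instance Definition _ (S : submodClosed M) :=
  GRing.isOppClosed.Build M (S : {pred M})
    (GRing.zmod_closedN (GRing.submod_closedB (submodClosedP S))).

Lemma submodP (K : submodClosed M) : submod_prop (fun x => x \in K).
Proof. by split=> [|a u v uK vK]; rewrite ?rpred0 // rpredD // rpredZ. Qed.

End PropSubmodules.

Section SubmoduleConstructions.
Variables (R : pzRingType).
Implicit Types M N : lmodType R.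

Lemma zero_sub_prop M : submod_prop (fun x : M => x = 0).
Proof. by split=> // a u v -> ->; rewrite scaler0 addr0. Qed.
Definition zero_sub M : submodClosed M := psub (zero_sub_prop M).

Lemma full_sub_prop M : submod_prop (fun _ : M => True).
Proof. by []. Qed.
Definition full_sub M : submodClosed M := psub (full_sub_prop M).

Lemma preim_sub_prop M N (f : {linear M -> N}) (K : submodClosed N) :
  submod_prop (fun x => f x \in K).
Proof.
split=> [|a u v uK vK]; first by rewrite linear0 rpred0.
by rewrite linearP rpredD // rpredZ.
Qed.
Definition preim_sub M N (f : {linear M -> N}) K : submodClosed M :=
  psub (preim_sub_prop f K).

Lemma add_sub_prop M (K L : submodClosed M) :
  submod_prop (fun x => exists2 u, u \in K & exists2 v, v \in L & x = u + v).
Proof.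
split; first by exists 0; rewrite ?rpred0 //; exists 0; rewrite ?rpred0 ?addr0.
move=> a x y [u uK [v vL ->]] [u' u'K [v' v'L ->]].
exists (a *: u + u'); first by rewrite rpredD // rpredZ.
exists (a *: v + v'); first by rewrite rpredD // rpredZ.
by rewrite scalerDr addrACA.
Qed.
Definition add_sub M (K L : submodClosed M) : submodClosed M :=
  psub (add_sub_prop K L).

Definition ker_sub M N (f : {linear M -> N}) : submodClosed M :=
  preim_sub f (zero_sub N).

End SubmoduleConstructions.

Section Quotient.
Variables (R : pzRingType) (M : lmodType R) (K : submodClosed M).

(* K again, but as a [zmodClosed], which is not inferred for K itself. *)
Let zK : zmodClosed M := psub (submodP K).

Definition qmod : Type := Quotient.quot zK.
HB.instance Definition _ := GRing.Zmodule.on qmod.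

Definition qproj (x : M) : qmod := \pi_(Quotient.quot zK) x.

Lemma qproj_eq x y : qproj x = qproj y <-> x - y \in K.
Proof.
rewrite -(psubP (submodP K)) (_ : (_ \in _) = (x == y %[mod Quotient.quot zK])).
  by split=> /eqP.
exact: (@Quotient.idealrBE M zK x y).
Qed.

Lemma qproj_surj (y : qmod) : exists x, qproj x = y.
Proof. by exists (repr (y : Quotient.quot zK)); rewrite /qproj reprK. Qed.

Lemma qprojB : zmod_morphism qproj.
Proof. exact: (@raddfB _ _ (\pi_(Quotient.quot zK))). Qed.
HB.instance Definition _ := GRing.isZmodMorphism.Build M qmod qproj qprojB.

Definition qmod_repr (y : qmod) : M := repr (y : Quotient.quot zK).

Lemma qmod_reprK : cancel qmod_repr qproj.
Proof. by move=> y; rewrite /qproj reprK. Qed.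

Definition qmod_scale (a : R) (y : qmod) : qmod := qproj (a *: qmod_repr y).

Lemma qmod_scaleE a x : qmod_scale a (qproj x) = qproj (a *: x).
Proof.
by apply/qproj_eq; rewrite -scalerBr rpredZ //; apply/qproj_eq; exact: qmod_reprK.
Qed.

Lemma qmod_scaleA a b y : qmod_scale a (qmod_scale b y) = qmod_scale (a * b) y.
Proof. by have [x <-] := qproj_surj y; rewrite !qmod_scaleE scalerA. Qed.

Lemma qmod_scale1 : left_id 1 qmod_scale.
Proof. by move=> y; have [x <-] := qproj_surj y; rewrite qmod_scaleE scale1r. Qed.

Lemma qmod_scaleDr : right_distributive qmod_scale +%R.
Proof.
move=> a y y'; have [[x <-] [x' <-]] := (qproj_surj y, qproj_surj y').
by rewrite -raddfD !qmod_scaleE scalerDr raddfD.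
Qed.

Lemma qmod_scaleDl y : {morph qmod_scale^~ y : a b / a + b}.
Proof.
by move=> a b; have [x <-] := qproj_surj y; rewrite !qmod_scaleE scalerDl raddfD.
Qed.

HB.instance Definition _ := GRing.Zmodule_isLmodule.Build R qmod
  qmod_scaleA qmod_scale1 qmod_scaleDr qmod_scaleDl.

Lemma qproj_scalable : scalable qproj.
Proof. by move=> a x; rewrite -qmod_scaleE. Qed.
HB.instance Definition _ := GRing.isScalable.Build R M qmod *:%R qproj qproj_scalable.

End Quotient.

Section RadicalAndSocle.
Variables (R : pzRingType) (M : lmodType R).
Implicit Types K L N S : submodClosed M.

Definition maximal_in K N : Prop :=
  [/\ {subset K <= N}, exists2 x, x \in N & x \notin K
    & forall L, {subset K <= L} -> {subset L <= N} ->
        {subset L <= K} \/ {subset N <= L}].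

Lemma rad_prop N :
  submod_prop (fun x => x \in N /\ forall K, maximal_in K N -> x \in K).
Proof.
split; first by split=> [|K _]; rewrite rpred0.
move=> a u v [uN uK] [vN vK]; split; first by rewrite rpredD // rpredZ.
by move=> K maxK; rewrite rpredD ?rpredZ ?uK ?vK.
Qed.

(* Rad N for a submodule N of M, viewed as a module: the intersection of the
   maximal submodules of N. *)
Definition rad N : submodClosed M := psub (rad_prop N).

Fixpoint rad_series (j : nat) : submodClosed M :=
  if j is j'.+1 then rad (rad_series j') else full_sub M.

Definition simple_sub S : Prop :=
  (exists2 x, x \in S & x != 0) /\
  forall L, {subset L <= S} -> (forall x, x \in L -> x = 0) \/ {subset S <= L}.

Lemma soc_prop :
  submod_prop (fun x : M => forall K,
    (forall S, simple_sub S -> {subset S <= K}) -> x \in K).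
Proof.
split=> [K _|a u v uS vS K HK]; first by rewrite rpred0.
by rewrite rpredD ?rpredZ ?uS ?vS.
Qed.

(* The sum of all simple submodules, as the least submodule containing them. *)
Definition soc : submodClosed M := psub soc_prop.

(* [loewy_length m]: m is the Loewy length of M, i.e. the least m such that
   Rad^m M = 0. *)
Definition loewy_length (m : nat) : Prop :=
  (forall x, x \in rad_series m -> x = 0) /\
  (forall j, (forall x, x \in rad_series j -> x = 0) -> (m <= j)%N).

End RadicalAndSocle.

Arguments rad_series {R} M j.
Arguments soc {R} M.
Arguments loewy_length {R} M m.

(* Soc_(j+1) M / Soc_j M = Soc (M / Soc_j M) *)
Fixpoint soc_series (R : pzRingType) (M : lmodType R) (j : nat) :
    submodClosed M :=
  if j is j'.+1 then
    preim_sub (@qproj R M (soc_series M j')) (soc (qmod (soc_series M j')))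
  else zero_sub M.
Arguments soc_series {R} M j.

Definition rigid (R : pzRingType) (M : lmodType R) : Prop :=
  exists2 m, loewy_length M m &
    forall j, (j <= m)%N -> rad_series M (m - j) =i soc_series M j.

Section RadicalFunctorial.
Variables (R : pzRingType) (M M' : lmodType R) (f : {linear M -> M'}).

Lemma rad_functorial (N : submodClosed M) (N' : submodClosed M') :
  (forall x, x \in N -> f x \in N') ->
  forall x, x \in rad N -> f x \in rad N'.
Proof.
move=> fN x /psubP[xN xrad]; apply/psubP; split; first exact: fN.
move=> K' [sK'N' _ maxK'].
have HK : submod_prop (fun y => y \in N /\ f y \in K').
  split=> [|a u v [uN uK] [vN vK]]; first by rewrite linear0 !rpred0.
  by rewrite linearP !rpredD // !rpredZ.
pose K : submodClosed M := psub HK.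
have [fNK'|nfNK'] := pselect (forall y, y \in N -> f y \in K').
  exact: fNK'.
suff /xrad/psubP[] : maximal_in K N by [].
split; first by move=> y /psubP[].
  move: nfNK' => /existsNP[y /not_implyP[yN /negP fyK']].
  by exists y => //; apply/negP => /psubP[_]; apply/negP.
move=> L sKL sLN.
have HL : submod_prop (fun y' => exists2 u, u \in L & y' - f u \in K').
  split; first by exists 0; rewrite ?linear0 ?subr0 ?addr0 ?rpred0.
  move=> a y z [u uL uK] [v vL vK]; exists (a *: u + v).
    by rewrite rpredD // rpredZ.
  by rewrite linearP opprD addrACA -scalerBr rpredD // rpredZ.
pose L' : submodClosed M' := psub HL.
have sK'L' : {subset K' <= L'}.
  by move=> y yK'; apply/psubP; exists 0; rewrite ?linear0 ?subr0 ?addr0 ?rpred0.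
have sL'N' : {subset L' <= N'}.
  move=> y /psubP[u uL yuK']; rewrite -(subrK (f u) y) rpredD ?fN ?sLN //.
  exact: sK'N'.
have [sL'K'|sN'L'] := maxK' L' sK'L' sL'N'.
- left=> y yL; apply/psubP; split; first exact: sLN.
  by apply: sL'K'; apply/psubP; exists y; rewrite ?subrr ?rpred0.
- right=> y yN; have /psubP[u uL yuK'] := sN'L' _ (fN _ yN).
  rewrite -(subrK u y) rpredD // sKL //; apply/psubP.
  split; last by rewrite linearB.
  by rewrite rpredD ?rpredN ?(sLN _ uL).
Qed.

Lemma rad_series_functorial j x :
  x \in rad_series M j -> f x \in rad_series M' j.
Proof.
elim: j x => [|j IHj] x /=; first by move=> _; apply/psubP.
exact: rad_functorial IHj x.
Qed.

End RadicalFunctorial.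

(* R / Rad^m R, where Rad^m R is a radical of the left regular module; it is
   two-sided by [rad_ring_mulr]. *)
Section TruncatedRing.
Variables (R : pzRingType) (m : nat).

Let I : submodClosed R^o := rad_series R^o m.

Lemma rad_ring_mulr (a b : R) : (a : R^o) \in I -> (a * b : R^o) \in I.
Proof.
pose f (c : R^o) : R^o := (c : R) * b.
have flin : linear f.
  move=> c x y; rewrite /f mulrDl; congr (_ + _).
  exact: (esym (mulrA (c : R) x b)).
pose F := GRing.isLinear.Build R R^o R^o _ f flin.
pose g : {linear R^o -> R^o} := HB.pack f F.
exact: (@rad_series_functorial R R^o R^o g).
Qed.

Definition trunc_ring : Type := qmod I.
HB.instance Definition _ := GRing.Zmodule.on trunc_ring.

Definition trunc (a : R) : trunc_ring := @qproj R R^o I a.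
Definition trunc_repr (x : trunc_ring) : R := @qmod_repr R R^o I x.

Lemma trunc_reprK : cancel trunc_repr trunc.
Proof. exact: qmod_reprK. Qed.

Lemma trunc_eq (a b : R) : trunc a = trunc b <-> (a - b : R^o) \in I.
Proof. exact: (@qproj_eq R R^o I). Qed.

Lemma truncB : zmod_morphism trunc.
Proof. exact: (@qprojB R R^o I). Qed.
HB.instance Definition _ := GRing.isZmodMorphism.Build R trunc_ring trunc truncB.

Definition trunc_mul (x y : trunc_ring) : trunc_ring :=
  trunc (trunc_repr x * trunc_repr y).

Lemma trunc_mulE a b : trunc_mul (trunc a) (trunc b) = trunc (a * b).
Proof.
apply/trunc_eq; set a' := trunc_repr _; set b' := trunc_repr _.
have aI : (a' - a : R^o) \in I by apply/trunc_eq; rewrite trunc_reprK.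
have bI : (b' - b : R^o) \in I by apply/trunc_eq; rewrite trunc_reprK.
have -> : a' * b' - a * b = (a' - a) * b' + a * (b' - b).
  by rewrite mulrBl mulrBr addrA subrK.
by apply: rpredD; [exact: rad_ring_mulr | exact: (@rpredZ R R^o I a)].
Qed.

Let truncI (x : trunc_ring) : exists a, x = trunc a.
Proof. by exists (trunc_repr x); rewrite trunc_reprK. Qed.

Lemma trunc_mulA : associative trunc_mul.
Proof.
move=> x y z; have [[[a ->] [b ->]] [c ->]] := (truncI x, truncI y, truncI z).
by rewrite !trunc_mulE mulrA.
Qed.

Lemma trunc_mul1l : left_id (trunc 1) trunc_mul.
Proof. by move=> x; have [a ->] := truncI x; rewrite trunc_mulE mul1r. Qed.

Lemma trunc_mul1r : right_id (trunc 1) trunc_mul.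
Proof. by move=> x; have [a ->] := truncI x; rewrite trunc_mulE mulr1. Qed.

Lemma trunc_mulDl : left_distributive trunc_mul +%R.
Proof.
move=> x y z; have [[[a ->] [b ->]] [c ->]] := (truncI x, truncI y, truncI z).
by rewrite -raddfD !trunc_mulE mulrDl raddfD.
Qed.

Lemma trunc_mulDr : right_distributive trunc_mul +%R.
Proof.
move=> x y z; have [[[a ->] [b ->]] [c ->]] := (truncI x, truncI y, truncI z).
by rewrite -raddfD !trunc_mulE mulrDr raddfD.
Qed.

HB.instance Definition _ := GRing.Zmodule_isPzRing.Build trunc_ring
  trunc_mulA trunc_mul1l trunc_mul1r trunc_mulDl trunc_mulDr.

Lemma trunc_monoid_morphism : monoid_morphism trunc.
Proof. by split=> // a b; rewrite -trunc_mulE. Qed.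
HB.instance Definition _ :=
  GRing.isMonoidMorphism.Build R trunc_ring trunc trunc_monoid_morphism.

End TruncatedRing.

(* An (R / Rad^m R)-module, regarded as an R-module. *)
Section Inflation.
Variables (R : pzRingType) (m : nat) (P : lmodType (trunc_ring R m)).

Definition infl : Type := P.
HB.instance Definition _ := GRing.Zmodule.on infl.

Definition infl_scale (a : R) (x : infl) : infl := trunc m a *: (x : P).

Lemma infl_scaleA a b x : infl_scale a (infl_scale b x) = infl_scale (a * b) x.
Proof. by rewrite /infl_scale scalerA rmorphM. Qed.
Lemma infl_scale1 : left_id 1 infl_scale.
Proof. by move=> x; rewrite /infl_scale rmorph1 scale1r. Qed.
Lemma infl_scaleDr : right_distributive infl_scale +%R.
Proof. by move=> a x y; rewrite /infl_scale scalerDr. Qed.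
Lemma infl_scaleDl x : {morph infl_scale^~ x : a b / a + b}.
Proof. by move=> a b; rewrite /infl_scale rmorphD scalerDl. Qed.

HB.instance Definition _ := GRing.Zmodule_isLmodule.Build R infl
  infl_scaleA infl_scale1 infl_scaleDr infl_scaleDl.
End Inflation.

(* An R-module M with Rad^m M = 0, as an (R / Rad^m R)-module. *)
Section Deflation.
Variables (R : pzRingType) (m : nat) (M : lmodType R).
Hypothesis radM0 : forall x, x \in rad_series M m -> x = 0.

Lemma rad_ring_scale0 (a : R) (x : M) : (a : R^o) \in rad_series R^o m -> a *: x = 0.
Proof.
move=> aI; apply: radM0.
pose f (c : R^o) : M := (c : R) *: x.
have flin : linear f by move=> c u v; rewrite /f scalerDl scalerA.
pose F := GRing.isLinear.Build R R^o M _ f flin.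
pose g : {linear R^o -> M} := HB.pack f F.
exact: (@rad_series_functorial R R^o M g).
Qed.

Definition defl of (forall x, x \in rad_series M m -> x = 0) : Type := M.
Local Notation M' := (defl radM0).
HB.instance Definition _ := GRing.Zmodule.on M'.

Definition defl_scale (b : trunc_ring R m) (x : M') : M' :=
  trunc_repr b *: (x : M).

Lemma defl_scaleE (a : R) (x : M') : defl_scale (trunc m a) x = a *: (x : M).
Proof.
apply/eqP; rewrite -subr_eq0 -scalerBl; apply/eqP/rad_ring_scale0.
by apply/trunc_eq; rewrite trunc_reprK.
Qed.

Lemma defl_scaleA b c x : defl_scale b (defl_scale c x) = defl_scale (b * c) x.
Proof.
by rewrite -[b]trunc_reprK -[c]trunc_reprK -rmorphM !defl_scaleE scalerA.
Qed.
Lemma defl_scale1 : left_id 1 defl_scale.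
Proof. by move=> x; rewrite -(rmorph1 (trunc m)) defl_scaleE scale1r. Qed.
Lemma defl_scaleDr : right_distributive defl_scale +%R.
Proof. by move=> b x y; rewrite /defl_scale scalerDr. Qed.
Lemma defl_scaleDl x : {morph defl_scale^~ x : b c / b + c}.
Proof.
move=> b c.
by rewrite -[b]trunc_reprK -[c]trunc_reprK -rmorphD !defl_scaleE scalerDl.
Qed.

HB.instance Definition _ := GRing.Zmodule_isLmodule.Build (trunc_ring R m) M'
  defl_scaleA defl_scale1 defl_scaleDr defl_scaleDl.

Variables (P : lmodType (trunc_ring R m)) (f : {linear P -> M'}).

Definition infl_hom (x : infl P) : M := f x.

Lemma infl_hom_linear : linear infl_hom.
Proof.
move=> a x y; rewrite /infl_hom.
by rewrite [LHS](linearP f (trunc m a) x y) [X in X + _ = _]defl_scaleE.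
Qed.
HB.instance Definition _ :=
  GRing.isLinear.Build R (infl P) M _ infl_hom infl_hom_linear.

End Deflation.

Section ModuleNotions.
Variables (R : pzRingType).
Implicit Types M N : lmodType R.

Definition fin_gen M : Prop :=
  exists n (e : 'I_n -> M), forall x, exists c : 'I_n -> R,
    x = \sum_(i < n) c i *: e i.

Definition surj (T U : Type) (f : T -> U) : Prop := forall y, exists x, f x = y.

Definition projective M : Prop :=
  forall (X Y : lmodType R) (g : {linear X -> Y}) (f : {linear M -> Y}),
    surj g -> exists h : {linear M -> X}, forall x, g (h x) = f x.

Definition isomorphic M N : Prop :=
  exists f : {linear M -> N}, bijective f.

Definition indecomposable M : Prop :=
  (exists x : M, x != 0) /\
  forall K L : submodClosed M,
    (forall x, x \in K -> x \in L -> x = 0) ->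
    (forall x, x \in add_sub K L) ->
    (forall x, x \in K -> x = 0) \/ (forall x, x \in L -> x = 0).

Definition superfluous M (K : submodClosed M) : Prop :=
  forall L : submodClosed M,
    (forall x, x \in add_sub K L) -> forall x, x \in L.

Definition projective_cover M N (f : {linear M -> N}) : Prop :=
  [/\ fin_gen M, projective M, surj f & superfluous (ker_sub f)].

Definition proj_indec M : Prop :=
  [/\ fin_gen M, projective M & indecomposable M].

Definition complete_proj_indecs n (P : 'I_n -> lmodType R) : Prop :=
  [/\ forall i, proj_indec (P i),
      forall i j, isomorphic (P i) (P j) -> i = j
    & forall Q : lmodType R, proj_indec Q -> exists i, isomorphic Q (P i)].

End ModuleNotions.

Definition artinian (k : comNzRingType) : Prop :=
  forall I : nat -> submodClosed k^o,
    (forall n, {subset I n.+1 <= I n}) ->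
    exists N, forall n, (N <= n)%N -> I n =i I N.

Definition artin_algebra (k : comNzRingType) (A : algType k) : Prop :=
  artinian k /\ fin_gen (A : lmodType k).

(* Finite direct sums, as products over a finite index type. *)
Section DirectSum.
Variables (R : pzRingType) (I : finType) (M : I -> lmodType R).

Definition dsum : Type := forall i, M i.
HB.instance Definition _ := gen_eqMixin dsum.
HB.instance Definition _ := gen_choiceMixin dsum.

Definition dsum_add (x y : dsum) : dsum := fun i => x i + y i.
Definition dsum_opp (x : dsum) : dsum := fun i => - x i.
Definition dsum_zero : dsum := fun i => 0.
Definition dsum_scale (a : R) (x : dsum) : dsum := fun i => a *: x i.

Lemma dsum_ext (x y : dsum) : (forall i, x i = y i) -> x = y.
Proof. exact: functional_extensionality_dep. Qed.

Lemma dsum_addA : associative dsum_add.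
Proof. by move=> x y z; apply: dsum_ext => i; apply: addrA. Qed.
Lemma dsum_addC : commutative dsum_add.
Proof. by move=> x y; apply: dsum_ext => i; apply: addrC. Qed.
Lemma dsum_add0 : left_id dsum_zero dsum_add.
Proof. by move=> x; apply: dsum_ext => i; apply: add0r. Qed.
Lemma dsum_addN : left_inverse dsum_zero dsum_opp dsum_add.
Proof. by move=> x; apply: dsum_ext => i; apply: addNr. Qed.
HB.instance Definition _ :=
  GRing.isZmodule.Build dsum dsum_addA dsum_addC dsum_add0 dsum_addN.

Lemma dsum_scaleA a b x : dsum_scale a (dsum_scale b x) = dsum_scale (a * b) x.
Proof. by apply: dsum_ext => i; apply: scalerA. Qed.
Lemma dsum_scale1 : left_id 1 dsum_scale.
Proof. by move=> x; apply: dsum_ext => i; apply: scale1r. Qed.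
Lemma dsum_scaleDr : right_distributive dsum_scale +%R.
Proof. by move=> a x y; apply: dsum_ext => i; apply: scalerDr. Qed.
Lemma dsum_scaleDl x : {morph dsum_scale^~ x : a b / a + b}.
Proof. by move=> a b; apply: dsum_ext => i; apply: scalerDl. Qed.
HB.instance Definition _ := GRing.Zmodule_isLmodule.Build R dsum
  dsum_scaleA dsum_scale1 dsum_scaleDr dsum_scaleDl.

End DirectSum.

Section Hom.
Variables (R : pzRingType).
Implicit Types G M N : lmodType R.

Definition Hom G M : Type := {linear G -> M}.
Identity Coercion linear_of_Hom : Hom >-> GRing.Linear.type.
HB.instance Definition _ G M := gen_eqMixin (Hom G M).
HB.instance Definition _ G M := gen_choiceMixin (Hom G M).

Lemma Hom_ext G M (f g : Hom G M) : (forall x, f x = g x) -> f = g.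
Proof.
move: f g => [f [[f1] [f2]]] [g [[g1] [g2]]] /= fg.
have {}fg : f = g by exact: funext.
case: _ / fg g1 g2 => g1 g2.
by rewrite (Prop_irrelevance f1 g1) (Prop_irrelevance f2 g2).
Qed.

Section Group.
Variables (G M : lmodType R).
Implicit Types f g h : Hom G M.

Definition Hom_add f g : Hom G M := (f : {linear G -> M}) \+ g.
Definition Hom_opp f : Hom G M := \- (f : {linear G -> M}).
Definition Hom_zero : Hom G M := (\0 : {linear G -> M}).

Lemma Hom_addA : associative Hom_add.
Proof. by move=> f g h; apply: Hom_ext => x; apply: addrA. Qed.
Lemma Hom_addC : commutative Hom_add.
Proof. by move=> f g; apply: Hom_ext => x; apply: addrC. Qed.
Lemma Hom_add0 : left_id Hom_zero Hom_add.
Proof. by move=> f; apply: Hom_ext => x; apply: add0r. Qed.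
Lemma Hom_addN : left_inverse Hom_zero Hom_opp Hom_add.
Proof. by move=> f; apply: Hom_ext => x; apply: addNr. Qed.
HB.instance Definition _ :=
  GRing.isZmodule.Build (Hom G M) Hom_addA Hom_addC Hom_add0 Hom_addN.
End Group.

Definition Hom_comp G M N (g : {linear M -> N}) (f : Hom G M) : Hom G N :=
  g \o f.

Section EndomorphismRing.
Variable G : lmodType R.

Definition EndR : Type := Hom G G.
HB.instance Definition _ := GRing.Zmodule.on EndR.

Definition End_mul (f g : EndR) : EndR := Hom_comp f g.
Definition End_one : EndR := (idfun : {linear G -> G}).

Lemma End_mulA : associative End_mul.
Proof. by move=> f g h; apply: Hom_ext. Qed.
Lemma End_mul1l : left_id End_one End_mul.
Proof. by move=> f; apply: Hom_ext. Qed.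
Lemma End_mul1r : right_id End_one End_mul.
Proof. by move=> f; apply: Hom_ext. Qed.
Lemma End_mulDl : left_distributive End_mul +%R.
Proof. by move=> f g h; apply: Hom_ext. Qed.
Lemma End_mulDr : right_distributive End_mul +%R.
Proof. by move=> f g h; apply: Hom_ext => x; apply: (linearD (f : Hom G G)). Qed.
HB.instance Definition _ := GRing.Zmodule_isPzRing.Build EndR
  End_mulA End_mul1l End_mul1r End_mulDl End_mulDr.
End EndomorphismRing.

Section LeftModule.
Variables (G M : lmodType R).

(* [(EndR G)^c] acts on the left of Hom(G, M) by precomposition. *)
Definition Hom_scale (r : (EndR G)^c) (f : Hom G M) : Hom G M := Hom_comp f r.

Lemma Hom_scaleA r s f : Hom_scale r (Hom_scale s f) = Hom_scale (r * s) f.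
Proof. by apply: Hom_ext. Qed.
Lemma Hom_scale1 : left_id 1 Hom_scale.
Proof. by move=> f; apply: Hom_ext. Qed.
Lemma Hom_scaleDr : right_distributive Hom_scale +%R.
Proof. by move=> r f g; apply: Hom_ext. Qed.
Lemma Hom_scaleDl f : {morph Hom_scale^~ f : r s / r + s}.
Proof. by move=> r s; apply: Hom_ext => x; apply: (linearD f). Qed.
HB.instance Definition _ := GRing.Zmodule_isLmodule.Build ((EndR G)^c) (Hom G M)
  Hom_scaleA Hom_scale1 Hom_scaleDr Hom_scaleDl.
End LeftModule.

Section Functor.
Variables (G M N : lmodType R) (g : {linear M -> N}).

Lemma Hom_comp_linear : linear (@Hom_comp G M N g).
Proof. by move=> r f f'; apply: Hom_ext => x; apply: (linearD g). Qed.
HB.instance Definition _ := GRing.isLinear.Build ((EndR G)^c) (Hom G M) (Hom G N)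
  _ (@Hom_comp G M N g) Hom_comp_linear.
End Functor.

End Hom.

(* The summand at (i, j), with j < l i, is P i / Rad^(j+1) (P i). *)
Definition ADR_module (R : pzRingType) n (P : 'I_n -> lmodType R)
    (l : 'I_n -> nat) : lmodType R :=
  dsum (fun p : {i : 'I_n & 'I_(l i)} =>
    (qmod (rad_series (P (tag p)) (tagged p).+1) : lmodType R)).

Definition ADR_algebra (R : pzRingType) n (P : 'I_n -> lmodType R)
    (l : 'I_n -> nat) : pzRingType := (EndR (ADR_module P l))^c.

Definition Hom_ADR (R : pzRingType) n (P : 'I_n -> lmodType R)
    (l : 'I_n -> nat) (M : lmodType R) : lmodType (ADR_algebra P l) :=
  Hom (ADR_module P l) M.

Definition Hom_ADR_map (R : pzRingType) n (P : 'I_n -> lmodType R)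
    (l : 'I_n -> nat) (M N : lmodType R) (g : {linear M -> N}) :
    {linear Hom_ADR P l M -> Hom_ADR P l N} :=
  @Hom_comp R (ADR_module P l) M N g.

(* Main.v *)
(** Let Q be the projective cover of M over A/Rad^m A. As A is a sum of copies of
    the P_i, Q is a summand of a sum of copies of the P_i/Rad^m P_i, so Q lies in
    add G and Hom(G, Q) is finitely generated projective. A map
    P_i/Rad^j P_i -> M has image in Soc_j M, which is Rad^(m-j) M by rigidity and
    so is the image of Rad^(m-j) Q; a lift P_i -> Rad^(m-j) Q kills Rad^j P_i since
    Rad^m Q = 0, so Hom(G, eps) is onto. Its kernel is superfluous because an
    endomorphism p of Q with eps p = eps is onto, hence split. *)

From HB Require Import structures.
Require Import Defs.
From mathcomp Require Import all_boot all_algebra.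
From mathcomp Require Import boolp.

(* Again, because [sesquilinear] exports a [rad] and [vector] a [Hom]. *)
Import Defs.

Set Implicit Arguments.
Unset Strict Implicit.
Unset Printing Implicit Defensive.

Import GRing.Theory.
Local Open Scope ring_scope.

(** * Submodules and the descending chain condition *)

Section LinearMaps.
Variable R : pzRingType.
Implicit Types M N : lmodType R.

Definition lin_of M N (f : M -> N) (flin : linear f) : {linear M -> N} :=
  HB.pack f (GRing.isLinear.Build R M N _ f flin).

Lemma qproj_eq0 M (K : submodClosed M) x : x \in K -> qproj K x = 0.
Proof.
by move=> xK; rewrite -(linear0 (@qproj R M K)); apply/qproj_eq; rewrite subr0.
Qed.

Section Lift.
Variables (M N : lmodType R) (f : {linear M -> N}) (K : submodClosed M).
Hypothesis fK0 : forall x, x \in K -> f x = 0.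

Let lift (y : qmod K) : N := f (qmod_repr y).

Let liftE x : lift (qproj K x) = f x.
Proof.
apply/eqP; rewrite -subr_eq0 -linearB; apply/eqP/fK0.
by apply/qproj_eq; exact: qmod_reprK.
Qed.

Let lift_linear : linear lift.
Proof.
move=> a y y'; have [[x <-] [x' <-]] := (qproj_surj y, qproj_surj y').
by rewrite -linearP !liftE linearP.
Qed.

Definition qlift : {linear qmod K -> N} := lin_of lift_linear.

Lemma qliftE x : qlift (qproj K x) = f x. Proof. exact: liftE. Qed.
End Lift.

Section SubmoduleType.
Variables (M : lmodType R) (K : submodClosed M).
(** Submodules are predicates; this makes one a module, so that projectivity can be applied to maps
    onto it and [compP] to a direct summand. *)
Record subm := Subm {subm_val : M; _ : subm_val \in K}.
HB.instance Definition _ := [isSub for subm_val].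
HB.instance Definition _ := [Choice of subm by <:].
HB.instance Definition _ := [SubChoice_isSubLmodule of subm by <:].

Let subm_val_linear : linear subm_val. Proof. by []. Qed.
Definition subm_incl : {linear subm -> M} := lin_of subm_val_linear.

Lemma subm_inP (x : subm) : subm_incl x \in K. Proof. exact: valP. Qed.
Lemma subm_incl_inj : injective subm_incl. Proof. exact: val_inj. Qed.
End SubmoduleType.
Arguments subm_incl {M K}.

Section Corestrict.
Variables (M N : lmodType R) (K : submodClosed N) (f : {linear M -> N}).
Hypothesis fK : forall x, f x \in K.
Let cor (x : M) : subm K := Subm (fK x).
Let cor_linear : linear cor.
Proof. by move=> a x y; apply: val_inj; rewrite /= linearP. Qed.
Definition corestrict : {linear M -> subm K} := lin_of cor_linear.
Lemma corestrictE x : subm_incl (corestrict x) = f x. Proof. by []. Qed.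
End Corestrict.

Section Image.
Variables (M N : lmodType R) (f : {linear M -> N}) (K : submodClosed M).
Lemma img_prop : submod_prop (fun y => exists2 x, x \in K & y = f x).
Proof.
split=> [|a _ _ [u uK ->] [v vK ->]]; first by exists 0; rewrite ?rpred0 ?linear0.
by exists (a *: u + v); rewrite ?rpredD ?rpredZ ?linearP.
Qed.
Definition img_sub : submodClosed N := psub img_prop.
Lemma img_subP y : y \in img_sub <-> exists2 x, x \in K & y = f x.
Proof. exact: psubP. Qed.
End Image.

Section Meet.
Variables (M : lmodType R) (K L : submodClosed M).
Lemma meet_prop : submod_prop (fun x => x \in K /\ x \in L).
Proof.
split=> [|a u v [uK uL] [vK vL]]; first by rewrite !rpred0.
by rewrite !rpredD ?rpredZ.
Qed.
Definition meet_sub : submodClosed M := psub meet_prop.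
Lemma meet_subP x : x \in meet_sub <-> x \in K /\ x \in L.
Proof. exact: psubP. Qed.
End Meet.
End LinearMaps.
Arguments subm_incl {R M K}.

Section DCC.
Variable R : pzRingType.
Implicit Types M N : lmodType R.

Definition dcc M : Prop :=
  forall I : nat -> submodClosed M,
    (forall n, {subset I n.+1 <= I n}) ->
    exists p, forall n, (p <= n)%N -> I n =i I p.

Lemma chain_subset M (I : nat -> submodClosed M) :
  (forall n, {subset I n.+1 <= I n}) ->
  forall p q, (p <= q)%N -> {subset I q <= I p}.
Proof.
move=> dI p q /subnK <-; elim: (q - p)%N => [//|d IHd] x.
by rewrite addSn => /dI /IHd.
Qed.

(** If every member of [F] had a strictly smaller one, choice and iteration from [K0] would give a
    chain that never stabilises. *)
Lemma dcc_min M (F : submodClosed M -> Prop) :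
  dcc M -> (exists K, F K) ->
  exists2 K, F K & forall L, F L -> {subset L <= K} -> {subset K <= L}.
Proof.
move=> dM [K0 FK0]; apply: contrapT => noMin.
have next (K : {K | F K}) : exists L : {L | F L},
    {subset sval L <= sval K} /\ ~ {subset sval K <= sval L}.
  case: K => K FK /=; apply: contrapT => noL; apply: noMin; exists K => // L FL sLK.
  by apply: contrapT => nKL; apply: noL; exists (exist _ L FL).
have [nx nxP] := choice next.
pose I i := sval (iter i nx (exist _ K0 FK0)).
have [p Ip] : exists p, forall i, (p <= i)%N -> I i =i I p.
  by apply: dM => i; exact: (nxP _).1.
case: (nxP (iter p nx (exist _ K0 FK0))) => _; apply=> x xI.
by rewrite -[sval (nx _)]/(I p.+1) Ip.
Qed.

Lemma dcc_image M N (f : {linear M -> N}) : surj f -> dcc M -> dcc N.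
Proof.
move=> fsurj dM I dI.
have [|p Ip] := dM (fun i => preim_sub f (I i)).
  by move=> i x /psubP fx; apply/psubP; exact: dI.
exists p => i /Ip Ii y; have [x <-] := fsurj y.
by have := Ii x; rewrite !psubE !asboolb.
Qed.

(** Induction on the number of generators: a chain is stable on the span of q+1 generators once it
    is stable on the span of the first q and its coefficients at the last one are stable. *)
Lemma fin_gen_dcc M : dcc (R^o : lmodType R) -> fin_gen M -> dcc M.
Proof.
move=> dR [n [e eP]] I dI.
(* The generators are continued by 0 beyond [n], so that spans can be indexed by any natural
   number. *)
pose e' j := if insub j is Some i then e i else 0.
pose S q x := exists c : nat -> R, x = \sum_(j < q) c j *: e' j.
have SB q x y : S q x -> S q y -> S q (x - y).
  move=> [c ->] [c' ->]; exists (fun j => c j - c' j).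
  by rewrite -sumrB; apply: eq_bigr => j _; rewrite scalerBl.
suff /(_ n)[p Ip] : forall q, exists p, forall i, (p <= i)%N ->
    forall x, S q x -> x \in I p -> x \in I i.
  exists p => i pi x; apply/idP/idP; first exact: chain_subset.
  apply: Ip => //; have [c ->] := eP x.
  exists (fun j => if insub j is Some k then c k else 0).
  by apply: eq_bigr => j _; rewrite /e' valK.
elim=> [|q [p Ip]].
  by exists 0%N => i _ x [c ->]; rewrite big_ord0 !rpred0.
(* The possible coefficients at generator [q], modulo [S q], form a left ideal, and the chain of
   these ideals stabilises by [dR]. *)
have Q i : submod_prop (fun r : R^o => exists2 s, S q s & s + (r : R) *: e' q \in I i).
  split.
    exists 0; last by rewrite scale0r addr0 rpred0.
    by exists (fun=> 0); rewrite big1 // => j _; rewrite scale0r.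
  move=> a u v [s [c sE] sI] [t [d tE] tI]; exists (a *: s + t).
    exists (fun j => a * c j + d j).
    rewrite sE tE scaler_sumr -big_split; apply: eq_bigr => j _ /=.
    by rewrite scalerDl scalerA.
  rewrite [X in X \in _](_ : _ = a *: (s + (u : R) *: e' q) + (t + (v : R) *: e' q)).
    by rewrite rpredD // rpredZ.
  by rewrite scalerDl -scalerA scalerDr addrACA.
have [|p' Ip'] := dR (fun i => psub (Q i)).
  by move=> i r /psubP[s Ss sI]; apply/psubP; exists s => //; exact: dI.
exists (maxn p p') => i; rewrite geq_max => /andP[pi p'i] x [c ->].
rewrite big_ord_recr /=; set s := \sum_(_ < _) _ => sI.
have Ss : S q s by exists c.
have : (c q : R^o) \in psub (Q i).
  rewrite Ip' //; apply/psubP; exists s => //.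
  by apply: chain_subset sI => //; rewrite leq_maxr.
move=> /psubP[s' Ss' s'I].
(* Two elements of [I p] with the same last coefficient differ by an element of [S q], where the
   chain is already stable. *)
have dE : s + c q *: e' q - (s' + c q *: e' q) = s - s'.
  by rewrite opprD addrACA subrr addr0.
rewrite -(subrK (s' + c q *: e' q) (_ + _)) rpredD // dE.
apply: Ip => //; first exact: SB.
rewrite -dE rpredD ?rpredN //.
  by apply: chain_subset sI => //; rewrite leq_maxl.
exact: chain_subset s'I.
Qed.

End DCC.

(** * Radical and socle series *)

Section RadicalSocle.
Variable R : pzRingType.
Implicit Types M N : lmodType R.

Lemma add_subP M (K L : submodClosed M) x :
  x \in add_sub K L <-> exists2 u, u \in K & exists2 v, v \in L & x = u + v.
Proof. exact: psubP. Qed.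

Lemma sub_add_subl M (K L : submodClosed M) : {subset K <= add_sub K L}.
Proof.
by move=> x xK; apply/add_subP; exists x => //; exists 0; rewrite ?addr0 ?rpred0.
Qed.

Lemma sub_add_subr M (K L : submodClosed M) : {subset L <= add_sub K L}.
Proof.
by move=> x xL; apply/add_subP; exists 0; rewrite ?rpred0 //; exists x; rewrite ?add0r.
Qed.

Lemma rad_sub M (N : submodClosed M) : {subset rad N <= N}.
Proof. by move=> x /psubP[]. Qed.

Lemma rad_mono M (N N' : submodClosed M) :
  {subset N <= N'} -> {subset rad N <= rad N'}.
Proof. by move=> sNN' x; apply: (rad_functorial (f := idfun)). Qed.

Lemma rad_series_anti M i j :
  (i <= j)%N -> {subset rad_series M j <= rad_series M i}.
Proof. by apply: chain_subset => p; exact: rad_sub. Qed.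

(* A minimal L with L + K = N works: if L :&: K were not in a maximal H < N,
   then N = (L :&: K) + H, and L :&: H would be a smaller choice. *)
Lemma rad_compl M (N K : submodClosed M) : dcc M -> {subset K <= N} ->
  exists L : submodClosed M,
    [/\ {subset L <= N}, forall x, x \in N -> exists2 l, l \in L & x - l \in K
      & forall x, x \in L -> x \in K -> x \in rad N].
Proof.
move=> dM sKN.
pose F (L : submodClosed M) := {subset L <= N} /\
  forall x, x \in N -> exists2 l, l \in L & x - l \in K.
have [|L [sLN LKN] minL] := dcc_min (F := F) dM.
  by exists N; split=> // x xN; exists x; rewrite ?subrr ?rpred0.
exists L; split=> // x xL xK; apply/psubP; split=> [|H [sHN [z zN zH] maxH]].
  exact: sKN.
pose T := meet_sub L K; apply: contrapT => /negP xH.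
have xT : x \in T by apply/meet_subP.
have [||sTH|sNT] := maxH (add_sub H T).
- exact: sub_add_subl.
- move=> y /add_subP[u uH [v /meet_subP[_ vK] ->]].
  by rewrite rpredD ?(sHN u) ?(sKN v).
- by case/negP: xH; apply/sTH/sub_add_subr.
have : F (meet_sub L H).
  split=> [y /meet_subP[/sLN]|y /LKN[l lL ylK]] //.
  have /sNT/add_subP[h hH [t /meet_subP[tL tK] lE]] := sLN _ lL.
  have hE : h = l - t by rewrite lE addrK.
  exists h; first by apply/meet_subP; split; rewrite // hE rpredD ?rpredN.
  by rewrite hE opprB addrA addrAC rpredD.
move=> /minL sL; have /meet_subP[_ xH'] : x \in meet_sub L H.
  by apply: sL => // y /meet_subP[].
by rewrite xH' in xH.
Qed.

(** Fails without a chain condition, as for Z onto Z/4. With [K] the part of [N] mapped into f(Rad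
    N), [rad_compl] gives y = f l + f r with l in [L] and r in Rad N; a maximal submodule of [N]
    missing l would yield a maximal submodule of f(N) missing f l. *)
Lemma rad_img M M' (f : {linear M -> M'}) (N : submodClosed M) y : dcc M ->
  y \in rad (img_sub f N) -> exists2 x, x \in rad N & y = f x.
Proof.
move=> dM yrad.
have HK : submod_prop (fun x => x \in N /\ exists2 r, r \in rad N & f x = f r).
  split; first by rewrite rpred0; split=> //; exists 0; rewrite ?rpred0.
  move=> a u v [uN [r rN fu]] [vN [s sN fv]]; split; first by rewrite rpredD ?rpredZ.
  by exists (a *: r + s); rewrite ?rpredD ?rpredZ // !linearP fu fv.
pose K : submodClosed M := psub HK.
have sKN : {subset K <= N} by move=> x /psubP[].
have [L [sLN LKN LK0]] := rad_compl dM sKN.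
have /img_subP[x xN yE] := rad_sub yrad.
have [l lL /psubP[_ [r rN fr]]] := LKN x xN.
exists (l + r); last by rewrite linearD -fr -linearD addrC subrK.
rewrite rpredD //; apply/psubP; split=> [|H maxHN]; first exact: sLN.
have [sHN _ maxH] := maxHN; apply: contrapT => /negP lH.
(* f(D) will be the maximal submodule of f(N). It misses f l because [L] and [K] meet inside Rad N,
   hence inside [H]. *)
pose D := add_sub (meet_sub L H) K.
have lfD : f l \notin img_sub f D.
  apply/negP => /img_subP[d /add_subP[l1 /meet_subP[l1L l1H] [k kK ->]] flE].
  have /psubP[kN [s sN fk]] := kK.
  case/negP: lH; rewrite -(subrK l1 l) rpredD //.
  have : l - l1 \in rad N.
    apply: LK0; first by rewrite rpredD ?rpredN.
    apply/psubP; split; first by rewrite rpredD ?rpredN ?sLN.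
    by exists s => //; rewrite linearB flE linearD fk addrC addKr.
  by move=> /psubP[_]; exact.
apply: (negP lfD); have : f l \in rad (img_sub f N).
  rewrite -(addrK (f r) (f l)) rpredD ?rpredN //.
    by rewrite -fr linearB addrC subrK -yE.
  by apply: rad_functorial rN => z zN; apply/img_subP; exists z.
move=> /psubP[_]; apply.
split.
- move=> _ /img_subP[z /add_subP[l1 /meet_subP[/sLN l1N _] [k /sKN kN ->]] ->].
  by apply/img_subP; exists (l1 + k); rewrite // rpredD.
- exists (f l) => //; apply/img_subP; exists l => //; exact: sLN.
move=> E sDE sEN.
(* A submodule [E] between f(D) and f(N) is tested by adding its preimage in [L] to [H]: staying in
   [H] forces E = f(D), reaching [N] forces E = f(N). *)
have [||sH|sN] := maxH (add_sub H (meet_sub L (preim_sub f E))).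
- exact: sub_add_subl.
- move=> z /add_subP[h /sHN hN [e /meet_subP[/sLN eN _] ->]]; exact: rpredD.
- left=> y' y'E; have /img_subP[z zN y'z] := sEN _ y'E; rewrite y'z.
  have [l2 l2L zl2K] := LKN z zN.
  have zl2D : z - l2 \in D by apply: sub_add_subr.
  apply/img_subP; exists z => //; rewrite -(subrK l2 z) rpredD //.
  apply: sub_add_subl; apply/meet_subP; split=> //.
  apply/sH/sub_add_subr/meet_subP; split=> //; apply/psubP.
  rewrite (_ : f l2 = y' - f (z - l2)).
    by rewrite rpredD ?rpredN //; apply: sDE; apply/img_subP; exists (z - l2).
  by rewrite y'z -linearB opprB addrC subrK.
- right=> _ /img_subP[z zN ->].
  have [l2 l2L zl2K] := LKN z zN.
  have zl2D : z - l2 \in D by apply: sub_add_subr.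
  rewrite -(subrK l2 z) linearD rpredD //.
    by apply: sDE; apply/img_subP; exists (z - l2).
  have /sN/add_subP[h hH [e /meet_subP[eL /psubP eE] l2E]] := sLN _ l2L.
  rewrite l2E linearD rpredD //; apply: sDE; apply/img_subP; exists h => //.
  apply/sub_add_subl/meet_subP; split=> //.
  by rewrite (_ : h = l2 - e) ?rpredD ?rpredN // l2E addrK.
Qed.

Lemma simple_exists M (L : submodClosed M) x : dcc M -> x \in L -> x != 0 ->
  exists2 S, simple_sub S & {subset S <= L}.
Proof.
move=> dM xL x0.
pose F (S : submodClosed M) :=
  {subset S <= L} /\ exists2 y, y \in S & y != 0.
have [|S [sSL Sn0] minS] := dcc_min (F := F) dM.
  by exists L; split=> //; exists x.
exists S => //; split=> // D sDS.
have [[y yD y0]|D0] := pselect (exists2 y, y \in D & y != 0).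
  by right; apply: minS => //; split=> [z /sDS/sSL|] //; exists y.
left=> y yD; apply/eqP; apply: contrapT => /negP y0; apply: D0.
by exists y.
Qed.

(** The [L] that [rad_compl] gives for the intersection of [N] and Soc M meets it in Rad N = 0. A
    simple submodule of [L] would lie in that intersection, so [L] has none and is 0 by
    [simple_exists]. *)
Lemma rad0_soc M (N : submodClosed M) : dcc M ->
  (forall x, x \in rad N -> x = 0) -> {subset N <= soc M}.
Proof.
move=> dM N0; pose K := meet_sub N (soc M).
have sKN : {subset K <= N} by move=> x /meet_subP[].
have [L [sLN LKN LK0]] := rad_compl dM sKN.
have L0 l : l \in L -> l = 0.
  move=> lL; apply/eqP; apply: contrapT => /negP l0.
  have [S simS sSL] := simple_exists dM lL l0.
  have [[y yS y0] _] := simS; case/eqP: y0; apply/N0/LK0; first exact: sSL.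
  apply/meet_subP; split; first exact/sLN/sSL.
  by apply/psubP => K' /(_ S simS); apply.
by move=> x /LKN[l /L0->]; rewrite subr0 => /meet_subP[].
Qed.

Lemma rad_series_img M M' (f : {linear M -> M'}) j y : dcc M -> surj f ->
  y \in rad_series M' j -> exists2 x, x \in rad_series M j & y = f x.
Proof.
move=> dM fsurj; elim: j y => [|j IHj] y /=.
  by move=> _; have [x <-] := fsurj y; exists x => //; apply/psubP.
move=> yr; apply: rad_img => //; apply: rad_mono yr => z /IHj zP.
exact/img_subP.
Qed.

(** By induction on t, f maps Rad^(j-t) M into Soc_t M'. Modulo Soc_t, the image of Rad^(j-t-1) M
    has as radical the image of Rad^(j-t) M, which is zero, so it lies in the socle. *)
Lemma soc_series_img M M' (f : {linear M -> M'}) j : dcc M -> dcc M' ->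
  (forall x, x \in rad_series M j -> f x = 0) ->
  forall x, f x \in soc_series M' j.
Proof.
move=> dM dM' fj0 x.
suff H t : (t <= j)%N ->
    forall x, x \in rad_series M (j - t) -> f x \in soc_series M' t.
  by apply: H (leqnn j) _ _; rewrite subnn; apply/psubP.
elim: t => [|t IHt] ltj z zr /=.
  by apply/psubP/fj0; rewrite subn0 in zr.
apply/psubP; set S := soc_series M' t.
pose g : {linear M -> qmod S} := @qproj R M' S \o f.
have dq : dcc (qmod S) by apply: dcc_image (@qproj_surj R M' S) dM'.
suff : {subset img_sub g (rad_series M (j - t.+1)) <= soc (qmod S)}.
  by apply; apply/img_subP; exists z.
apply: rad0_soc => // y /(rad_img dM)[u uN ->].
apply/qproj_eq0/IHt; first exact: ltnW.
by rewrite -[X in rad_series M X]prednK ?subn_gt0 // -subnS.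
Qed.
End RadicalSocle.

(** * Maps factoring through sums of modules *)

Section Factors.
Variable R : pzRingType.
Implicit Types U V W X Y Z : lmodType R.

Definition via (I : Type) (G : I -> lmodType R) X Y : Type :=
  {i : I & ({linear X -> G i} * {linear G i -> Y})%type}.

Definition through I (G : I -> lmodType R) X Y i
    (a : {linear X -> G i}) (b : {linear G i -> Y}) : via G X Y :=
  existT (fun i => ({linear X -> G i} * {linear G i -> Y})%type) i (a, b).

(* Not only single composites: f is a finite sum of maps passing through some
   G i. In particular [factors G id] on X says that X is in add G. *)
Definition factors (I : Type) (G : I -> lmodType R) X Y (f : X -> Y) : Prop :=
  exists s : seq (via G X Y),
    forall x, f x = \sum_(t <- s) (tagged t).2 ((tagged t).1 x).

Section Closure.
Variables (I : Type) (G : I -> lmodType R).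

Lemma factors_zero X Y (f : X -> Y) : (forall x, f x = 0) -> factors G f.
Proof. by move=> f0; exists [::] => x; rewrite big_nil. Qed.

Lemma factors_thru X Y (f : X -> Y) i (a : {linear X -> G i}) (b : {linear G i -> Y}) :
  (forall x, f x = b (a x)) -> factors G f.
Proof. by move=> fE; exists [:: through a b] => x; rewrite big_seq1 fE. Qed.

Lemma factors_add X Y (f g h : X -> Y) :
  (forall x, h x = f x + g x) -> factors G f -> factors G g -> factors G h.
Proof.
by move=> hE [s fE] [t gE]; exists (s ++ t) => x; rewrite hE fE gE big_cat.
Qed.

Lemma factors_comp X Y W Z (f : X -> Y) (u : {linear Y -> Z}) (v : {linear W -> X})
    (h : W -> Z) :
  (forall w, h w = u (f (v w))) -> factors G f -> factors G h.
Proof.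
move=> hE [s fE].
pose c (t : via G X Y) : via G W Z :=
  through ((tagged t).1 \o v : {linear W -> G (tag t)})
          (u \o (tagged t).2 : {linear G (tag t) -> Z}).
by exists [seq c t | t <- s] => w; rewrite hE fE linear_sum big_map.
Qed.

Lemma factors_sum X Y (J : Type) (r : seq J) (F : J -> X -> Y) (h : X -> Y) :
  (forall x, h x = \sum_(j <- r) F j x) -> (forall j, factors G (F j)) ->
  factors G h.
Proof.
elim: r h => [|j r IHr] h hE FG.
  by apply: factors_zero => x; rewrite hE big_nil.
apply: (factors_add (g := fun x => \sum_(j <- r) F j x) _ (FG j)).
  by move=> x; rewrite hE big_cons.
exact: IHr.
Qed.

End Closure.

Lemma factors_trans I (G : I -> lmodType R) J (H : J -> lmodType R) X Y (f : X -> Y) :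
  (forall j, factors G (@id (H j))) -> factors H f -> factors G f.
Proof.
move=> HG [s fE]; apply: factors_sum fE _ => t.
exact: (factors_comp (u := (tagged t).2) (v := (tagged t).1) _ (HG (tag t))).
Qed.

Lemma fin_gen_image X Y (f : {linear X -> Y}) : surj f -> fin_gen X -> fin_gen Y.
Proof.
move=> fsurj [n [e eP]]; exists n, (f \o e) => y; have [x <-] := fsurj y.
have [c ->] := eP x; exists c; rewrite linear_sum.
by apply: eq_bigr => i _; rewrite linearZ.
Qed.

Lemma projective_retract X Y (f : {linear X -> Y}) (g : {linear Y -> X}) :
  (forall y, f (g y) = y) -> projective X -> projective Y.
Proof.
move=> fg pX U V p h psurj.
have [k kP] := pX U V p (h \o f : {linear X -> V}) psurj.
by exists (k \o g : {linear Y -> U}) => y; rewrite /= kP /= fg.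
Qed.

(** A family with one member, so that [factors regular id] is the dual basis criterion for finitely
    generated projective modules. *)
Definition regular (_ : unit) : lmodType R := R^o.

Lemma dual_basis_fin_gen X : factors regular (@id X) -> fin_gen X.
Proof.
move=> [s sE]; exists (size s).
exists (fun i => (tagged (tnth (in_tuple s) i)).2 (1 : R)) => x.
exists (fun i => (tagged (tnth (in_tuple s) i)).1 x).
rewrite {1}(sE x) big_tnth; apply: eq_bigr => i _; set t := tnth _ i.
by rewrite -linearZ; congr (_ _); rewrite /GRing.scale /= mulr1.
Qed.

Lemma dual_basis_projective X : factors regular (@id X) -> projective X.
Proof.
move=> [s sE] U V g f gsurj.
have [v vP] := choice (fun y => gsurj y).
pose h x := \sum_(t <- s) ((tagged t).1 x : R) *: v (f ((tagged t).2 (1 : R))).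
have hlin : linear h.
  move=> a x y; rewrite /h scaler_sumr -big_split; apply: eq_bigr => t _ /=.
  by rewrite linearP scalerDl scalerA.
exists (lin_of hlin) => x; rewrite /= /h linear_sum (sE x) linear_sum.
apply: eq_bigr => t _; rewrite linearZ vP -linearZ -linearZ; congr (f (_ _)).
by rewrite -(sE x) /GRing.scale /= mulr1.
Qed.

Lemma projective_dual_basis X : fin_gen X -> projective X -> factors regular (@id X).
Proof.
move=> [n [e eP]] pX.
pose F : lmodType R := dsum (fun _ : 'I_n => (R^o : lmodType R)).
pose g (c : F) : X := \sum_(i < n) (c i : R) *: e i.
have glin : linear g.
  move=> a c d; rewrite /g scaler_sumr -big_split; apply: eq_bigr => i _ /=.
  by rewrite scalerA -scalerDl.
have [|h hE] := pX F X (lin_of glin) idfun.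
  by move=> x; have [c ->] := eP x; exists c.
apply: (factors_sum (r := index_enum 'I_n) (F := fun i x => (h x i : R) *: e i)).
  by move=> x; rewrite -[LHS]hE.
move=> i.
have alin : linear (fun x => h x i : R^o) by move=> a x y; rewrite linearP.
have blin : linear (fun c : R^o => (c : R) *: e i).
  by move=> a c d; rewrite scalerDl -scalerA.
exact: (@factors_thru unit regular X X _ tt (lin_of alin) (lin_of blin)).
Qed.

Lemma regular_fin_gen : fin_gen (R^o : lmodType R).
Proof.
apply: dual_basis_fin_gen.
exact: (@factors_thru unit regular R^o R^o _ tt idfun idfun).
Qed.

Lemma regular_projective : projective (R^o : lmodType R).
Proof.
apply: dual_basis_projective.
exact: (@factors_thru unit regular R^o R^o _ tt idfun idfun).
Qed.

Section TruncMap.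
Variables (X Y : lmodType R) (f : {linear X -> Y}) (m : nat).
Let pf : {linear X -> qmod (rad_series Y m)} := @qproj R Y _ \o f.
Let pf0 x : x \in rad_series X m -> pf x = 0.
Proof.
by move=> xm; apply/qproj_eq0/rad_series_functorial.
Qed.
Definition trunc_map : {linear qmod (rad_series X m) -> qmod (rad_series Y m)} :=
  qlift pf0.
Lemma trunc_mapE x : trunc_map (qproj _ x) = qproj _ (f x).
Proof. by rewrite qliftE. Qed.
End TruncMap.

(** X/Rad^m X is an additive functor of X, acting on maps by [trunc_map], so it preserves
    decompositions of the identity. *)
Lemma factors_trunc I (G : I -> lmodType R) X m : factors G (@id X) ->
  factors (fun i => qmod (rad_series (G i) m) : lmodType R)
    (@id (qmod (rad_series X m))).
Proof.
move=> [s sE].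
pose G' i : lmodType R := qmod (rad_series (G i) m).
pose c (t : via G X X) : via G' (qmod (rad_series X m)) (qmod (rad_series X m)) :=
  @through I G' _ _ (tag t) (trunc_map (tagged t).1 m) (trunc_map (tagged t).2 m).
exists [seq c t | t <- s] => y; have [x <-] := qproj_surj y.
rewrite big_map {1}(sE x) linear_sum; apply: eq_bigr => t _.
rewrite -[RHS]/(trunc_map (tagged t).2 m (trunc_map (tagged t).1 m (qproj _ x))).
by rewrite !trunc_mapE.
Qed.

Lemma complement_projection Z (K L : submodClosed Z) :
  (forall x, x \in K -> x \in L -> x = 0) -> (forall x, x \in add_sub K L) ->
  exists2 p : {linear Z -> Z}, forall z, p z \in K & forall z, z - p z \in L.
Proof.
move=> KL0 KLT.
have [z|p pP] := choice (X := Z) (Y := Z) (P := fun z u => u \in K /\ z - u \in L).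
  have /add_subP[u uK [v vL zE]] := KLT z.
  by exists u; split; rewrite // zE addrC addKr.
have plin : linear p.
  move=> a x y; apply/eqP; rewrite -subr_eq0; apply/eqP; apply: KL0.
    by rewrite rpredD ?rpredN ?(pP _).1 // rpredD ?rpredZ ?(pP _).1.
  rewrite (_ : _ - _ = a *: (x - p x) + (y - p y) - (a *: x + y - p (a *: x + y))).
    by rewrite rpredD ?rpredN ?(pP _).2 // rpredD ?rpredZ ?(pP _).2.
  by rewrite scalerBr addrACA -opprD opprB [RHS]addrC addrA subrK.
by exists (lin_of plin) => z; have [] := pP z.
Qed.

(* A minimal summand of X whose projection does not factor through P would be
   indecomposable. *)
Lemma proj_indec_factors n (P : 'I_n -> lmodType R) X :
  complete_proj_indecs P -> dcc X -> fin_gen X -> projective X -> factors P (@id X).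
Proof.
move=> [_ _ compP] dX fgX pX; apply: contrapT => nPX.
pose F (K : submodClosed X) := exists e : {linear X -> X},
  [/\ forall x, e x \in K, forall x, x \in K -> e x = x & ~ factors P e].
have [|K [e [eK eid nPe]] minK] := dcc_min (F := F) dX.
  by exists (full_sub X), idfun; split=> // x; apply/psubP.
pose Z : lmodType R := subm K.
pose c : {linear X -> Z} := corestrict eK.
pose i : {linear Z -> X} := subm_incl.
have ic x : i (c x) = e x by [].
have ci z : c (i z) = z by apply: subm_incl_inj; rewrite corestrictE eid ?subm_inP.
(* A projection of [Z] whose complement is nonzero factors through [P]: otherwise minimality would
   put [K] inside the image of [K1], and l would lie in both [K1] and [L1]. *)
have part (p : {linear Z -> Z}) (K1 L1 : submodClosed Z) :
    (forall x, x \in K1 -> x \in L1 -> x = 0) -> (exists2 z, z \in L1 & z != 0) ->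
    (forall z, p z \in K1) -> (forall z, z - p z \in L1) ->
    factors P (fun x => i (p (c x))).
  move=> KL0 [l lL l0] pK pL; apply: contrapT => nf.
  have /minK : F (img_sub i K1).
    exists (i \o (p \o c)); split=> // [x|_ /img_subP[k kK ->]].
      by apply/img_subP; exists (p (c x)).
    rewrite -[LHS]/(i (p (c (i k)))) ci; congr (i _).
    apply/esym/eqP; rewrite -subr_eq0; apply/eqP/KL0 => //.
    by rewrite rpredD ?rpredN.
  have sKK : {subset img_sub i K1 <= K}.
    by move=> _ /img_subP[k _ ->]; apply: subm_inP.
  move=> /(_ sKK (i l) (subm_inP l))/img_subP[k kK /subm_incl_inj lk].
  by case/eqP: l0; apply: KL0 => //; rewrite lk.
have indZ : indecomposable Z.
  split.
    apply: contrapT => Z0; apply: nPe; apply: factors_zero => x; rewrite -ic.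
    rewrite (_ : c x = 0) ?linear0 //; apply/eqP; apply: contrapT => /negP cx0.
    by apply: Z0; exists (c x).
  move=> K1 L1 KL0 KLT; apply: contrapT => nKL.
  have [p pK pL] := complement_projection KL0 KLT.
  have nz (S : submodClosed Z) : ~ (forall x, x \in S -> x = 0) ->
      exists2 z, z \in S & z != 0.
    move=> nS; apply: contrapT => nS'; apply: nS => x xS; apply/eqP.
    by apply: contrapT => /negP x0; apply: nS'; exists x.
  (* Both summands being nonzero, [part] applies to each of the two projections, and these add up to
     the identity of [Z]. *)
  pose q : {linear Z -> Z} := (idfun : {linear Z -> Z}) \- p.
  apply: nPe; apply: (factors_add (f := fun x => i (p (c x)))
                                  (g := fun x => i (q (c x)))).
  - by move=> x; rewrite -linearD /q /= addrC subrK.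
  - by apply: part KL0 _ pK pL; apply: nz => L0; apply: nKL; right.
  - apply: (part q L1 K1) => [x xL xK|||z].
    + exact: KL0.
    + by apply: nz => K0; apply: nKL; left.
    + exact: pL.
    + by rewrite /q /= opprB addrC subrK.
have [|j [f [g fK gK]]] := compP Z.
  split=> //; first by apply: fin_gen_image fgX => z; exists (i z); apply: ci.
  exact: projective_retract ci pX.
have glin : linear g by move=> a x y; apply: (can_inj fK); rewrite linearP !gK.
apply: nPe.
apply: (@factors_thru _ _ _ _ _ j (f \o c : {linear X -> P j})
  (i \o (lin_of glin : {linear P j -> Z}) : {linear P j -> X})).
by move=> x; rewrite /= fK.
Qed.

End Factors.

(** * Lifting along a projective cover of a rigid module *)

Section DirectSumMaps.
Variables (R : pzRingType) (I : finType) (M : I -> lmodType R).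

Let proj_linear i : linear (fun x : dsum M => x i). Proof. by []. Qed.
Definition dsum_proj i : {linear dsum M -> M i} := lin_of (proj_linear i).

Let inj i (x : M i) : dsum M := fun j =>
  if eqP is ReflectT e then ecast j (M j : Type) (e : i = j) x else 0.

Let injE i (x : M i) : inj x i = x.
Proof. by rewrite /inj; case: eqP => // e; rewrite eq_axiomK. Qed.

Let inj_neq i j (x : M i) : i != j -> inj x j = 0.
Proof. by rewrite /inj => /eqP; case: eqP. Qed.

Let inj_linear i : linear (@inj i).
Proof.
move=> a x y; apply: dsum_ext => j; rewrite -[RHS]/(a *: inj x j + inj y j).
have [<-|ij] := eqVneq i j; first by rewrite !injE.
by rewrite !inj_neq // scaler0 addr0.
Qed.
Definition dsum_inj i : {linear M i -> dsum M} := lin_of (@inj_linear i).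

Lemma dsum_injK i x : dsum_proj i (dsum_inj i x) = x. Proof. exact: injE. Qed.

Lemma dsum_sum (x : dsum M) : x = \sum_i dsum_inj i (dsum_proj i x).
Proof.
apply: dsum_ext => j; rewrite -[RHS]/(dsum_proj j _) linear_sum (bigD1 j) //=.
rewrite injE big1 ?addr0 // => i ij; exact: inj_neq.
Qed.
End DirectSumMaps.

Lemma Hom_sumE (R : pzRingType) (G M : lmodType R) (J : Type) (s : seq J)
    (F : J -> Hom G M) x :
  (\sum_(j <- s) F j) x = \sum_(j <- s) F j x.
Proof. by elim/big_rec2: _ => // j _ f _ <-. Qed.

Section HomFunctor.
Variables (R : pzRingType) (G Q M : lmodType R).
Hypothesis GQ : factors (fun _ : unit => G) (@id Q).

(** If id_Q is the sum of the b_t a_t, then f is the sum of the a_t f acting on b_t: the b_t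
    generate Hom(G, Q), and the maps f |-> a_t f are coordinates, linear because End(G) acts by
    precomposition. *)
Lemma Hom_dual_basis : factors (@regular (EndR G)^c) (@id (Hom G Q)).
Proof.
have [s sE] := GQ.
have alin (a : {linear Q -> G}) :
    linear (fun f : Hom G Q => Hom_comp a f : ((EndR G)^c)^o).
  by move=> r f g; apply: Hom_ext => x; apply: (linearD a).
have blin (b : {linear G -> Q}) :
    linear (fun r : ((EndR G)^c)^o => Hom_comp b (r : EndR G) : Hom G Q).
  by move=> r f g; apply: Hom_ext => x; apply: (linearD b).
pose c (t : via (fun _ : unit => G) Q Q) :
    via (@regular (EndR G)^c) (Hom G Q) (Hom G Q) :=
  @through _ _ (@regular _) _ _ tt
    (lin_of (alin (tagged t).1)) (lin_of (blin (tagged t).2)).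
exists [seq c t | t <- s] => f; apply: Hom_ext => x; rewrite big_map.
by rewrite Hom_sumE {1}(sE (f x)).
Qed.

(* If ker + L is everything, the coordinates of id_Q = sum_t b_t a_t can be moved
   into L, giving p = sum_t b'_t a_t with f p = f; as p q = id, every g is the
   combination sum_t b'_t (a_t q g) of elements of L. *)
Lemma Hom_ker_superfluous (f : {linear Q -> M}) :
  (forall p : {linear Q -> Q}, (forall x, f (p x) = f x) ->
    exists q : {linear Q -> Q}, forall x, p (q x) = x) ->
  superfluous (ker_sub (@Hom_comp R G Q M f)).
Proof.
move=> fsplit L KL g; have [s sE] := GQ.
have dec (b : Hom G Q) : exists b', b' \in L /\ forall x, f (b' x) = f (b x).
  have /add_subP[k /psubP/psubP fk0 [b' b'L ->]] := KL b.
  exists b'; split=> // x; rewrite -[(k + b') x]/(k x + b' x) linearD.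
  have -> : f (k x) = Hom_comp f k x by [].
  by rewrite fk0 add0r.
have [d dP] := choice dec.
pose p x := \sum_(t <- s) d (tagged t).2 ((tagged t).1 x).
have plin : linear p.
  move=> a x y; rewrite /p scaler_sumr -big_split; apply: eq_bigr => t _ /=.
  by rewrite !linearP.
have [|q pq] := fsplit (lin_of plin).
  move=> x; rewrite /= /p {2}(sE x) !linear_sum; apply: eq_bigr => t _.
  exact: (dP _).2.
suff -> : g = \sum_(t <- s)
    (Hom_comp (tagged t).1 (Hom_comp q g) : (EndR G)^c) *: d (tagged t).2.
  by apply: rpred_sum => t _; apply: rpredZ; apply: (dP _).1.
apply: Hom_ext => x.
by rewrite Hom_sumE -[LHS]pq.
Qed.
End HomFunctor.

Section TruncatedModules.
Variables (R : pzRingType) (m : nat).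

(** [trunc_ring] and the quotient module share a carrier; matching their scalars lets [infl_factors]
    reread maps over one ring as maps over the other. *)
Lemma trunc_scaleE (a : R) (x : trunc_ring R m) :
  trunc m a * x = a *: (x : qmod (rad_series R^o m)).
Proof.
rewrite -[x]trunc_reprK -rmorphM; apply/esym.
exact: (@qmod_scaleE R R^o).
Qed.

Section Maps.
Variables P P' : lmodType (trunc_ring R m).

Let infl_map_linear (f : {linear P -> P'}) : linear (fun x : infl P => f x : infl P').
Proof. by move=> a x y; apply: (linearP f). Qed.
Definition infl_map (f : {linear P -> P'}) : {linear infl P -> infl P'} :=
  lin_of (infl_map_linear f).

Let defl_map_linear (f : {linear infl P -> infl P'}) : linear (fun x : P => f x : P').
Proof.
by move=> b x y; rewrite -[b]trunc_reprK; apply: (linearP f (trunc_repr b) x y).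
Qed.
Definition defl_map (f : {linear infl P -> infl P'}) : {linear P -> P'} :=
  lin_of (defl_map_linear f).
End Maps.

Lemma infl_fin_gen (P : lmodType (trunc_ring R m)) : fin_gen P -> fin_gen (infl P).
Proof.
move=> [n [e eP]]; exists n, e => x; have [c ->] := eP x.
exists (fun i => trunc_repr (c i)); apply: eq_bigr => i _.
by rewrite -{1}[c i]trunc_reprK.
Qed.

Lemma infl_factors (P : lmodType (trunc_ring R m)) :
  factors (@regular (trunc_ring R m)) (@id P) ->
  factors (fun _ : unit => qmod (rad_series R^o m) : lmodType R) (@id (infl P)).
Proof.
move=> [s sE].
have alin (a : {linear P -> (trunc_ring R m)^o}) :
    linear (fun x : infl P => a x : qmod (rad_series R^o m)).
  by move=> r x y; rewrite -trunc_scaleE; apply: (linearP a).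
have blin (b : {linear (trunc_ring R m)^o -> P}) :
    linear (fun x : qmod (rad_series R^o m) => b x : infl P).
  by move=> r x y; rewrite -trunc_scaleE; apply: (linearP b).
exists [seq @through _ _ (fun _ : unit => qmod (rad_series R^o m) : lmodType R) _ _ tt
    (lin_of (alin (tagged t).1)) (lin_of (blin (tagged t).2)) | t <- s] => x.
by rewrite big_map {1}(sE x).
Qed.

(** The quotient map carries Rad^m X onto Rad^m of the quotient, by [rad_series_img]. *)
Lemma rad_trunc0 (X : lmodType R) x : dcc X ->
  x \in rad_series (qmod (rad_series X m)) m -> x = 0.
Proof.
move=> dX /(rad_series_img dX (@qproj_surj R X _))[y ym ->].
exact: qproj_eq0.
Qed.

Lemma factors_rad0 I (G : I -> lmodType R) (X : lmodType R) : factors G (@id X) ->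
  (forall i x, x \in rad_series (G i) m -> x = 0) ->
  forall x, x \in rad_series X m -> x = 0.
Proof.
move=> [s sE] G0 x xm; rewrite (sE x) big1 // => t _.
by rewrite (G0 _ ((tagged t).1 x)) ?linear0 //; apply: rad_series_functorial.
Qed.
End TruncatedModules.

(* The image of f lies in Soc_j M = Rad^(m-j) M, which is covered by Rad^(m-j) Q,
   and a map X -> Rad^(m-j) Q kills Rad^j X. *)
Lemma rigid_lift (R : pzRingType) (X Q M : lmodType R) (m j : nat)
    (e : {linear Q -> M}) (f : {linear qmod (rad_series X j) -> M}) :
  projective X -> dcc X -> dcc Q -> dcc M -> surj e ->
  (forall x, x \in rad_series Q m -> x = 0) ->
  (forall i, (i <= m)%N -> rad_series M (m - i) =i soc_series M i) ->
  exists h : {linear qmod (rad_series X j) -> Q}, forall y, e (h y) = f y.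
Proof.
move=> pX dX dQ dM esurj Qm0 rigM; pose a := (m - j)%N.
pose f0 : {linear X -> M} := f \o @qproj R X _.
have f0a x : f0 x \in rad_series M a.
  (* If j > m, the truncated difference [a] is 0 and Rad^a M is all of M. *)
  rewrite /a; have [jm|/ltnW] := leqP j m; last first.
    by rewrite -subn_eq0 => /eqP->; apply/psubP.
  rewrite rigM //; apply: soc_series_img => // z zj.
  by rewrite /f0 /= qproj_eq0 ?linear0.
pose N := rad_series Q a.
have ea (x : subm N) : (e \o subm_incl : {linear subm N -> M}) x \in rad_series M a.
  exact: (@rad_series_functorial R Q M e a _ (subm_inP x)).
have [|h0 h0E] := pX _ _ (corestrict ea) (corestrict f0a).
  move=> y; have [x xN yE] := rad_series_img dQ esurj (subm_inP y).
  by exists (Subm xN); apply: subm_incl_inj.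
pose h1 : {linear X -> Q} := subm_incl \o h0.
have h1r t x : x \in rad_series X t -> h1 x \in rad_series Q (t + a).
  elim: t x => [|t IHt] x; first by move=> _; apply: subm_inP.
  exact: rad_functorial.
have h1j x : x \in rad_series X j -> h1 x = 0.
  move=> /h1r xj; apply: Qm0; apply: rad_series_anti xj.
  by rewrite /a -leq_subLR.
exists (qlift h1j) => y; have [x <-] := qproj_surj y; rewrite qliftE.
by rewrite -[RHS]/(f0 x) -(corestrictE f0a) -h0E.
Qed.

(** Left ideals of [A] are k-submodules, because k acts through the elements [a%:A]. *)
Lemma algebra_dcc (k : comNzRingType) (A : algType k) :
  dcc (A : lmodType k) -> dcc (A^o : lmodType A).
Proof.
move=> dA I dI.
have Ik i : submod_prop (fun x : A => (x : A^o) \in I i).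
  split=> [|a u v uI vI]; first exact: (rpred0 (I i)).
  rewrite -mulr_algl; exact: (rpredD (rpredZ (a%:A : A) uI) vI).
have [|p Ip] := dA (fun i => psub (Ik i)).
  by move=> i x /psubP xI; apply/psubP; apply: dI.
by exists p => i pi x; have := Ip i pi x; rewrite !psubE !asboolb.
Qed.

(** Submodules with the same elements still give distinct quotient types; the two [qlift] maps
    identify them. *)
Lemma factors_qmod (R : pzRingType) (X : lmodType R) (K K' : submodClosed X) I
    (G : I -> lmodType R) :
  K =i K' -> factors G (@id (qmod K)) -> factors G (@id (qmod K')).
Proof.
move=> KK'.
have KK'0 x : x \in K -> @qproj R X K' x = 0 by rewrite KK'; apply: qproj_eq0.
have K'K0 x : x \in K' -> @qproj R X K x = 0 by rewrite -KK'; apply: qproj_eq0.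
apply: (factors_comp (u := qlift KK'0) (v := qlift K'K0)) => w.
by have [x <-] := qproj_surj w; rewrite /id (qliftE K'K0) (qliftE KK'0).
Qed.

(** For 1 <= m <= l_i the quotient is one of the summands of G. For larger m both Rad^m P_i and
    Rad^(l_i) P_i vanish, so the last summand serves; for m = 0 the quotient is zero. *)
Lemma ADR_trunc_factors (R : pzRingType) n (P : 'I_n -> lmodType R) l
    (lP : forall i, loewy_length (P i) (l i)) (P0 : forall i, exists x : P i, x != 0)
    i m :
  factors (fun _ : unit => ADR_module P l) (@id (qmod (rad_series (P i) m))).
Proof.
have [rl0 _] := lP i.
have l0 : (0 < l i)%N.
  rewrite lt0n; apply/eqP => li0; have [x /eqP[]] := P0 i.
  by apply: rl0; rewrite li0; apply/psubP.
case: m => [|m].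
  apply: factors_zero => y; have [x <-] := qproj_surj y.
  by apply: qproj_eq0; apply/psubP.
(* The exponent is now m + 1, and position j of the sum carries Rad^(j+1), so the position is m cut
   off at l_i - 1. *)
have tl : (minn m (l i).-1 < l i)%N by rewrite gtn_min ltn_predL l0 orbT.
pose p : {i : 'I_n & 'I_(l i)} := Tagged _ (Ordinal tl).
pose G (p : {i : 'I_n & 'I_(l i)}) : lmodType R :=
  qmod (rad_series (P (tag p)) (tagged p).+1).
apply: (@factors_qmod _ _ (rad_series (P i) (minn m (l i).-1).+1)).
  move=> x; have [//|lm] := leqP m (l i).-1; rewrite prednK //.
  have lm' : (l i <= m.+1)%N by rewrite (leq_trans (leqSpred _)) // ltnW.
  apply/idP/idP => [/rl0->|]; first by rewrite rpred0.
  exact: rad_series_anti.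
apply: (@factors_thru _ unit (fun _ => ADR_module P l) (G p) (G p) id tt
  (dsum_inj G p) (dsum_proj G p)) => x.
by rewrite dsum_injK.
Qed.

Theorem corollary5p2 (k : comNzRingType) (A : algType k)
  (artinA : artin_algebra A)
  (n : nat) (P : 'I_n -> lmodType A) (compP : complete_proj_indecs P)
  (l : 'I_n -> nat) (lP : forall i, loewy_length (P i) (l i))
  (M : lmodType A) (fgM : fin_gen M) (rigidM : rigid M)
  (m : nat) (llM : loewy_length M m)
  (Q : lmodType (trunc_ring A m)) (eps : {linear Q -> defl (proj1 llM)})
  (coverM : projective_cover eps) :
  projective_cover (Hom_ADR_map P l (infl_hom eps : {linear infl Q -> M})).
Proof.
have [dk fgA] := artinA; have [piP _ _] := compP.
have [fgQ pQ eps_surj ker_small] := coverM.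
have dA : dcc (A^o : lmodType A) := algebra_dcc (fin_gen_dcc dk fgA).
have dM : dcc M := fin_gen_dcc dA fgM.
have dQ : dcc (infl Q) := fin_gen_dcc dA (infl_fin_gen fgQ).
(* As an A-module, [Q] lies in add(A/Rad^m A); hence Rad^m Q = 0. *)
have QA := infl_factors (projective_dual_basis fgQ pQ).
have Qm0 := factors_rad0 QA (fun _ x => rad_trunc0 dA (x := x)).
have P0 i : exists x : P i, x != 0 by have [_ _ []] := piP i.
(* add(A/Rad^m A) is contained in the add of the P_i/Rad^m P_i, and that in add G. *)
have QG : factors (fun _ : unit => ADR_module P l) (@id (infl Q)).
  apply: factors_trans QA => _.
  apply: factors_trans (fun i => ADR_trunc_factors lP P0 i m) _.
  apply: factors_trunc; apply: proj_indec_factors compP dA _ _.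
    exact: regular_fin_gen.
  exact: regular_projective.
(* Rigidity comes with its own Loewy length, equal to [m] since both are minimal. *)
have rigM i : (i <= m)%N -> rad_series M (m - i) =i soc_series M i.
  have [m' [r0 rmin] rigM] := rigidM.
  suff -> : m = m' by exact: rigM.
  by apply/eqP; rewrite eqn_leq llM.2 // rmin //; exact: llM.1.
pose e : {linear infl Q -> M} := infl_hom eps.
have eE x : e x = eps x by [].
split.
- exact: (dual_basis_fin_gen (Hom_dual_basis QG)).
- exact: (dual_basis_projective (Hom_dual_basis QG)).
- move=> g.
  pose S (p : {i : 'I_n & 'I_(l i)}) : lmodType A :=
    qmod (rad_series (P (tag p)) (tagged p).+1).
  have lift p : exists h : {linear S p -> infl Q},
      forall y, e (h y) = (g : {linear dsum S -> M}) (dsum_inj S p y).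
    have [fgP pP _] := piP (tag p).
    exact: (@rigid_lift _ (P (tag p)) (infl Q) M m _ e (g \o dsum_inj S p)
      pP (fin_gen_dcc dA fgP) dQ dM).
  pose h x := \sum_p sval (cid (lift p)) (dsum_proj S p x).
  have hlin : linear h.
    move=> a x y; rewrite /h scaler_sumr -big_split; apply: eq_bigr => p _ /=.
    by rewrite !linearP.
  exists (lin_of hlin : Hom (ADR_module P l) (infl Q)); apply: Hom_ext => x.
  rewrite -[LHS]/(e (h x)) {2}(dsum_sum x) !linear_sum; apply: eq_bigr => p _.
  by case: (cid _).
apply: (Hom_ker_superfluous QG (f := e)) => p ep.
have [|q qP] := pQ Q Q (defl_map p) idfun.
  move=> y; suff /img_subP[x _ ->] : y \in img_sub (defl_map p) (full_sub Q).
    by exists x.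
  apply: ker_small => {}y; apply/add_subP.
  exists (y - p y).
    by apply/psubP/psubP; rewrite linearB -!eE ep subrr.
  exists (p y); last by rewrite subrK.
  by apply/img_subP; exists y => //; apply/psubP.
by exists (infl_map q) => x; apply: qP.
Qed.
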